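(* Let $k$ be a field and let $\Theta$ be a finite simple oriented graph with vertices $V(\Theta)=\{x_1,x_2,\dots,x_n\}$. Extend the order $x_1<x_2<\cdots<x_n$ on $V(\Theta)$ to the deg-lex order on the free monoid $F=\langle V(\Theta)\rangle$. Let $T$ be the set of all the following pairs (reductions): \begin{itemize} \item[(i)] $(twt,\,tw)$, for any $t\in V(\Theta)$ and $w\in F$ such that $w\nrightarrow t$; \item[(ii)] $(twt,\,wt)$, for any $t\in V(\Theta)$ and $w\in F$ such that $t\nrightarrow w$; \item[(iii)] $(t_1wt_2,\,t_2t_1w)$, for any $t_1,t_2\in V(\Theta)$ and $w\in F$ such that $t_1>t_2$ and $t_2\nleftrightarrow t_1w$. \end{itemize} Then the set $\{w-v : (w,v)\in T\}\subseteq k[F]$ is a Gröbner basis of the Hecke--Kiselman algebra $k[\mathrm{HK}_\Theta]$.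
   Context: A finite simple oriented graph is a finite directed graph without loops in which any two distinct vertices are either not connected or connected by exactly one arrow. The Hecke--Kiselman monoid $\mathrm{HK}_\Theta$ is the monoid generated by the vertices $x_1,\dots,x_n$ subject to: $x_i^2=x_i$ for all $i$; $x_ix_j=x_jx_i$ if $x_i,x_j$ are not connected in $\Theta$; $x_ix_jx_i=x_jx_ix_j=x_ix_j$ if there is an arrow $x_i\to x_j$ in $\Theta$. $k[\mathrm{HK}_\Theta]$ is its monoid algebra. $F$ is the free monoid (with empty word $1$) on $V(\Theta)$, and $k[F]$ is the free algebra. The deg-lex order on $F$ compares words first by length, then lexicographically. For $w\in F$ and a generator $t$, $|w|_t$ is the number of occurrences of $t$ in $w$, and $\mathrm{supp}(w)=\{t: |w|_t>0\}$. For $t\in V(\Theta)$ and $w\in F$: $w\nrightarrow t$ means $|w|_t=0$ and there is no $x\in\mathrm{supp}(w)$ with an arrow $x\to t$ in $\Theta$; $t\nrightarrow w$ means $|w|_t=0$ and there is no $y\in\mathrm{supp}(w)$ with an arrow $t\to y$ in $\Theta$; $t\nleftrightarrow w$ means that both $t\nrightarrow w$ and $w\nrightarrow t$ hold. A word $u$ is a factor of $v$ if $v=aub$ for some $a,b\in F$. Let $J=\ker(k[F]\to k[\mathrm{HK}_\Theta])$ for the natural homomorphism. A subset $G\subseteq J$ is a Gröbner basis of $J$ (or of $k[\mathrm{HK}_\Theta]$) if $0\notin G$, $G$ generates $J$ as an ideal, and for every nonzero $f\in J$ there is $g\in G$ such that the leading monomial of $g$ is a factor of the leading monomial of $f$ (leading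 monomials with respect to the deg-lex order). *)

(* Defs.v *)
From HB Require Import structures.
From mathcomp Require Import all_boot all_order all_algebra.
From mathcomp Require Import generic_quotient.
From mathcomp Require Import finmap.
From mathcomp Require Import boolp.
From mathcomp.multinomials Require Import monalg.

Set Implicit Arguments.
Unset Strict Implicit.
Unset Printing Implicit Defensive.

Import Order.TTheory GRing.Theory.

Local Open Scope ring_scope.
Local Open Scope quotient_scope.

Local Notation "x '*m' y" := (@mmul _ x y) (at level 40, left associativity).

(* [e x y] means that there is an arrow from x to y. The vertices x_1 < ... < x_n
   are the elements of 'I_n in their natural order. *)
Definition oriented_graph n (e : rel 'I_n) :=
  irreflexive e /\ forall x y, ~~ (e x y && e y x).

Section HeckeKiselman.
Context {n : nat} (e : rel 'I_n).

Let F := {fmonom 'I_n}.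
Let x_ (i : 'I_n) : F := fmu i.

Inductive hk_rel : F -> F -> Prop :=
| hk_idem i : hk_rel (x_ i *m x_ i) (x_ i)
| hk_comm i j : ~~ e i j -> ~~ e j i -> hk_rel (x_ i *m x_ j) (x_ j *m x_ i)
| hk_arrow_l i j : e i j -> hk_rel (x_ i *m x_ j *m x_ i) (x_ i *m x_ j)
| hk_arrow_r i j : e i j -> hk_rel (x_ j *m x_ i *m x_ j) (x_ i *m x_ j).

Inductive hk_cong : F -> F -> Prop :=
| hk_cong_rel u v : hk_rel u v -> hk_cong u v
| hk_cong_refl u : hk_cong u u
| hk_cong_sym u v : hk_cong u v -> hk_cong v u
| hk_cong_trans v u w : hk_cong u v -> hk_cong v w -> hk_cong u w
| hk_cong_mul u u' v v' :
    hk_cong u u' -> hk_cong v v' -> hk_cong (u *m v) (u' *m v').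

Definition hk_congb (u v : F) : bool := `[< hk_cong u v >].

Fact hk_congb_refl : reflexive hk_congb.
Proof. by move=> u; apply/asboolP/hk_cong_refl. Qed.

Fact hk_congb_sym : symmetric hk_congb.
Proof. by move=> u v; apply/asboolP/asboolP; apply: hk_cong_sym. Qed.

Fact hk_congb_trans : transitive hk_congb.
Proof.
move=> v u w /asboolP uv /asboolP vw.
by apply/asboolP; apply: hk_cong_trans uv vw.
Qed.

Canonical hk_equiv := EquivRel hk_congb hk_congb_refl hk_congb_sym hk_congb_trans.

Definition HK := {eq_quot hk_equiv}.
HB.instance Definition _ := Choice.on HK.
HB.instance Definition _ := EqQuotient.on HK.

Definition hk_pi (u : F) : HK := \pi_HK u.

Lemma hk_piP u v : hk_pi u = hk_pi v <-> hk_cong u v.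
Proof.
split=> [/eqmodP/asboolP//|uv].
by apply/eqmodP/asboolP.
Qed.

Definition hk_one : HK := hk_pi mone.
Definition hk_mul (a b : HK) : HK := hk_pi (repr a *m repr b).

Lemma hk_pi_mul u v : hk_pi (u *m v) = hk_mul (hk_pi u) (hk_pi v).
Proof.
by apply/hk_piP/hk_cong_mul; apply/hk_piP; rewrite /hk_pi reprK.
Qed.

Lemma hk_piW (P : HK -> Prop) : (forall u, P (hk_pi u)) -> forall a, P a.
Proof. by move=> Pu a; rewrite -[a]reprK; apply: Pu. Qed.

Fact hk_mulA : associative hk_mul.
Proof.
elim/hk_piW=> u; elim/hk_piW=> v; elim/hk_piW=> w.
by rewrite -!hk_pi_mul mulmA.
Qed.

Fact hk_mul1 : left_id hk_one hk_mul.
Proof. by elim/hk_piW=> u; rewrite -hk_pi_mul mul1m. Qed.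

Fact hk_mulr1 : right_id hk_one hk_mul.
Proof. by elim/hk_piW=> u; rewrite -hk_pi_mul mulm1. Qed.

(* [monomType] asks that the unit be the only invertible element. This holds
   for every HK monoid since no defining relation involves the empty word. *)
Lemma hk_cong_size0 u v : hk_cong u v -> (size u == 0%N) = (size v == 0%N).
Proof.
elim=> {u v} [u v uv|//|//|v u w _ -> _ ->//|u u' v v' _ uu' _ vv'].
  by case: uv => * ; rewrite !fmM !fmU.
by rewrite !fmM !size_cat !addn_eq0 uu' vv'.
Qed.

Fact hk_unitm a b : hk_mul a b = hk_one -> a = hk_one /\ b = hk_one.
Proof.
elim/hk_piW: a => u; elim/hk_piW: b => v; rewrite -hk_pi_mul.
move=> /hk_piP/hk_cong_size0; rewrite fm1 eqxx => /eqP.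
move=> /fdeg_eq0I/unitm[-> ->].
by [].
Qed.

HB.instance Definition _ :=
  Choice_isMonomialDef.Build HK hk_mulA hk_mul1 hk_mulr1 hk_unitm.

End HeckeKiselman.

Section HeckeKiselmanAlgebra.
Context {n : nat} (k : fieldType) (e : rel 'I_n).

Let F := {fmonom 'I_n}.

Definition hk_word (w : F) : {malg k[HK e]} := << hk_pi e w >>.

Fact hk_word_mmorphism : mmorphism hk_word.
Proof.
split=> [u v|]; last by [].
by rewrite /hk_word malgM_def fgmulUU mulr1 hk_pi_mul.
Qed.

HB.instance Definition _ :=
  isMultiplicative.Build F {malg k[HK e]} hk_word hk_word_mmorphism.

Definition hk_nat : {malg k[F]} -> {malg k[HK e]} :=
  mmap (@malgC (HK e) k) hk_word.

Fact hk_nat_zmod_morphism : zmod_morphism hk_nat.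
Proof. exact: raddfB. Qed.

HB.instance Definition _ :=
  GRing.isZmodMorphism.Build {malg k[F]} {malg k[HK e]} hk_nat
    hk_nat_zmod_morphism.

Fact hk_nat_monoid_morphism : monoid_morphism hk_nat.
Proof.
have comm (f : {malg k[F]}) u v :
    GRing.comm (f@_u)%:MP (hk_word v).
  by rewrite /GRing.comm !malgM_def !fgmulUU mulrC mulm1 mul1m.
by have [hM h1] := commr_mmap_is_multiplicative comm; split.
Qed.

HB.instance Definition _ :=
  GRing.isMonoidMorphism.Build {malg k[F]} {malg k[HK e]} hk_nat
    hk_nat_monoid_morphism.

Lemma hk_natU c w : hk_nat << c *g w >> = << c *g hk_pi e w >>.
Proof.
by rewrite /hk_nat mmapU malgM_def fgmulUU mulr1 mul1m.
Qed.

Definition hk_ideal (f : {malg k[F]}) : Prop := hk_nat f = 0.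

End HeckeKiselmanAlgebra.

Arguments hk_ideal {n} k e f.

Section Groebner.
Context {n : nat} {k : fieldType}.

Let F := {fmonom 'I_n}.
Implicit Types (f : {malg k[F]}) (u v : F) (J G : {malg k[F]} -> Prop).

Definition deglex_le u v : bool :=
  (size u < size v)%N
  || (size u == size v) && ((u : seqlexi 'I_n) <= (v : seqlexi 'I_n))%O.

Definition lead_monomial f u : Prop :=
  u \in msupp f /\ forall v, v \in msupp f -> deglex_le v u.

Definition word_factor u v : Prop := exists a b, v = a *m u *m b.

Definition two_sided_ideal_gen G f : Prop :=
  exists s : seq ({malg k[F]} * {malg k[F]} * {malg k[F]}),
    (forall p, p \in s -> G p.1.2) /\ f = \sum_(p <- s) p.1.1 * p.1.2 * p.2.

Definition groebner_basis J G : Prop :=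
  [/\ forall g, G g -> J g,
      ~ G 0,
      forall f, J f <-> two_sided_ideal_gen G f
    & forall f, J f -> f != 0 ->
        exists g u v, [/\ G g, lead_monomial g u, lead_monomial f v
                        & word_factor u v]].

End Groebner.

Section Reductions.
Context {n : nat} (e : rel 'I_n).

Let F := {fmonom 'I_n}.
Implicit Types (t : 'I_n) (w : F).

Definition occ t w : nat := count_mem t w.
Definition word_supp w : {set 'I_n} := [set t | (0 < occ t w)%N].

Definition no_arrow_to w t : bool :=
  (occ t w == 0%N) && ~~ [exists x in word_supp w, e x t].
Definition no_arrow_from t w : bool :=
  (occ t w == 0%N) && ~~ [exists y in word_supp w, e t y].
Definition no_arrow t w : bool := no_arrow_from t w && no_arrow_to w t.

Inductive hk_reduction : F -> F -> Prop :=
| red_i t w : no_arrow_to w t ->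
    hk_reduction (fmu t *m w *m fmu t) (fmu t *m w)
| red_ii t w : no_arrow_from t w ->
    hk_reduction (fmu t *m w *m fmu t) (w *m fmu t)
| red_iii t1 t2 w : (t2 < t1)%O -> no_arrow t2 (fmu t1 *m w) ->
    hk_reduction (fmu t1 *m w *m fmu t2) (fmu t2 *m fmu t1 *m w).

Definition hk_reduction_set (k : fieldType) (f : {malg k[F]}) : Prop :=
  exists w v : F, hk_reduction w v /\ f = << w >> - << v >>.

End Reductions.

Arguments hk_reduction_set {n} e k f.

(* Main.v *)
Require Import Defs.
From mathcomp Require Import all_boot all_order all_algebra.
From mathcomp Require Import generic_quotient finmap boolp.
From mathcomp.multinomials Require Import monalg.
From Stdlib Require Import Relations_3_facts.

Set Implicit Arguments.
Unset Strict Implicit.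
Unset Printing Implicit Defensive.

Import Order.TTheory GRing.Theory.

(** The relations of the monoid HK allow two kinds of moves on words: exchanging
adjacent letters that are not joined by an arrow, and deleting a letter. If
[u = a t b], this [t] may be deleted when an earlier [t] in [a] reaches it
without crossing a letter having an arrow to [t], or when a later [t] in [b]
reaches it without crossing a letter to which [t] has an arrow. Reductions (i)
and (ii) are the deletions, reduction (iii) is an exchange that puts a smaller
letter first.

Three facts make the theorem work.

- Exchanges are invisible in the projections of a word on two joined letters
  (or on a single letter), so equality of all these projections ([trace_eq]) is
  used as equivalence under exchanges. Whether a letter can be deleted depends
  only on these projections, hence deletion is compatible with this equivalence
  ([del_trace_eq]).

- Deletions at two distinct places of a word either can be performed one after
  the other, or concern two occurrences of the same letter with no neighbour of it
  in between, in which case the two results are equivalent under exchanges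
  ([del_diamond]). So deletion modulo exchanges is strongly confluent, and two
  words represent the same element of HK if and only if they reduce to
  equivalent words.
  In particular, if no letter of [v] can be deleted, every word congruent
  to [v] and not longer than [v] is equivalent to [v] under exchanges
  ([joinable_shortest]).

- If [u] and [v] are equivalent under exchanges and [u] is lexicographically
  smaller, then the letter with which [u] continues after their common prefix
  occurs later in [v], behind letters not joined to it and starting with a
  larger one: this is the left side of a reduction (iii) ([lexi_trace_eq]).

Together: a word that is not the deg-lex minimum of its class in HK contains the
left side of a reduction ([smaller_cong_reducible]). If [f] lies in the kernel and
[v] is its leading monomial, the coefficients of [f] on the class of [v] sum to
zero, so another, smaller, monomial of [f] is congruent to [v], and [v] is
reducible. That the differences generate the kernel follows by replacing each
monomial of [f] by a fixed representative of its class. *)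

(** * Decompositions of words at a letter *)

Section SplittingWords.
Context {T : eqType}.
Implicit Types (a b c : seq T) (s t x y : T).

Lemma eq_cat_cons a1 s b1 a2 t b2 : a1 ++ s :: b1 = a2 ++ t :: b2 ->
  [\/ [/\ a1 = a2, s = t & b1 = b2],
      exists c, a2 = a1 ++ s :: c /\ b1 = c ++ t :: b2
    | exists c, a1 = a2 ++ t :: c /\ b2 = c ++ s :: b1].
Proof.
elim: a1 a2 => [|x a1 IH] [|y a2] /= [<-].
- by move=> <-; constructor 1.
- by move=> ->; constructor 2; exists a2.
- by move=> <-; constructor 3; exists a1.
move=> /IH[[-> -> ->]|[c [-> ->]]|[c [-> ->]]].
- by constructor 1.
- by constructor 2; exists c.
- by constructor 3; exists c.
Qed.

Lemma count_split t k b : (k < count_mem t b)%N ->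
  exists b1 b2, b = b1 ++ t :: b2 /\ count_mem t b1 = k.
Proof.
elim: b k => [|x b IH] k //=; have [->|neq] := eqVneq x t; last first.
  rewrite add0n => /IH[b1 [b2 [-> <-]]].
  by exists (x :: b1), b2; rewrite /= (negbTE neq).
case: k => [|k]; first by exists [::], b.
rewrite ltnS => /IH[b1 [b2 [-> <-]]].
by exists (t :: b1), b2; rewrite /= eqxx.
Qed.

Lemma eq_cat_count t a b a' b' : count_mem t a = count_mem t a' ->
  a ++ t :: b = a' ++ t :: b' -> a = a' /\ b = b'.
Proof.
move=> eq_ct /eq_cat_cons[[]|[c [def_a' _]]|[c [def_a _]]] //; move: eq_ct.
  rewrite def_a' count_cat /= eqxx => /eqP.
  by rewrite -{1}[count_mem t a]addn0 eqn_add2l.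
rewrite def_a count_cat /= eqxx => /esym/eqP.
by rewrite -{1}[count_mem t a']addn0 eqn_add2l.
Qed.

End SplittingWords.

(** * A letter reached by another occurrence of it *)

Section Absorption.
Context {T : eqType}.
Implicit Types (d : rel T) (a b c : seq T) (t x y : T).

(** A letter [t] in front of such a [b] is redundant in HK when [d] is the arrow
relation; for a [t] behind a word, [b] is the reversed word and [d] the opposite
relation. Further occurrences of [t] are harmless: the first one decides. *)
Fixpoint absorbs d t b : bool :=
  if b is x :: b' then (x == t) || ~~ d t x && absorbs d t b' else false.

Lemma absorbs_cat d t b1 b2 :
  absorbs d t (b1 ++ b2) =
  absorbs d t b1 || all (fun x => ~~ d t x) b1 && absorbs d t b2.
Proof.
elim: b1 => //= x b1 ->.
by case: (x == t); case: (d t x); case: absorbs.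
Qed.

Lemma absorbs_split d t b : absorbs d t b ->
  exists b1 b2, [/\ b = b1 ++ t :: b2, t \notin b1 & all (fun x => ~~ d t x) b1].
Proof.
elim: b => [|x b IH] //=; have [->|neq] := eqVneq x t.
  by exists [::], b.
case/andP=> ndx /IH[b1 [b2 [-> tb1 ndb1]]].
by exists (x :: b1), b2; rewrite /= inE eq_sym negb_or neq ndx.
Qed.

Lemma absorbs_mem d t b : absorbs d t b -> t \in b.
Proof. by move=> /absorbs_split[b1 [b2 [-> _ _]]]; rewrite mem_cat mem_head orbT. Qed.

Lemma mem_absorbs d t b : t \in b -> all (fun x => ~~ d t x) b -> absorbs d t b.
Proof.
elim: b => //= x b IH; rewrite inE eq_sym => /orP[->//|tb] /andP[-> nb].
by rewrite IH ?orbT.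
Qed.

(** This form shows that absorption depends only on the projections of the word on
pairs of letters, so that it survives exchanges of unjoined letters. *)
Lemma absorbs_proj d t b : ~~ d t t ->
  absorbs d t b <->
  t \in b /\ forall x, d t x -> head t [seq y <- b | pred2 t x y] = t.
Proof.
move=> ndtt; elim: b => [|y b [IH1 IH2]] /=; first by split=> [|[]].
rewrite inE eq_sym; have [->|neq] /= := eqVneq t y; first by split.
have [dty|ndty] /= := boolP (d t y).
  split=> [//|[_ /(_ y dty)]].
  rewrite eqxx /= => eq_yt.
  by rewrite eq_yt eqxx in neq.
have skip x : d t x -> (y == x) = false.
  by move=> dtx; apply: contraNF ndty => /eqP->.
split=> [/IH1|] [tb hb]; [split=> //|apply: IH2; split=> //] => x dtx.
  by rewrite (skip x dtx); apply: hb.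
by have := hb x dtx; rewrite (skip x dtx).
Qed.

Lemma eq_absorbs d t b b' : ~~ d t t ->
  (forall x, (t == x) || d t x ->
     [seq y <- b | pred2 t x y] = [seq y <- b' | pred2 t x y]) ->
  absorbs d t b = absorbs d t b'.
Proof.
move=> ndtt eqb; have memE (c : seq T) : (t \in c) = (t \in [seq y <- c | pred2 t t y]).
  by rewrite mem_filter /= eqxx.
apply/idP/idP=> /(absorbs_proj _ ndtt)[tb hb]; apply/(absorbs_proj _ ndtt).
  rewrite memE -eqb ?eqxx // -memE; split=> // x dtx.
  by rewrite -eqb ?hb // dtx orbT.
rewrite memE eqb ?eqxx // -memE; split=> // x dtx.
by rewrite eqb ?hb // dtx orbT.
Qed.

(** Deleting a letter of a word can only destroy the absorption if the deleted
letter is itself the absorbing one. *)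
Lemma absorbs_del d s t c b : absorbs d s (c ++ t :: b) ->
  absorbs d s (c ++ b) || (t == s) && all (fun x => ~~ d s x) c.
Proof.
rewrite !absorbs_cat /=; case: (absorbs d s c); rewrite //= => /andP[-> ].
by case/orP=> [->|/andP[_ ->]]; rewrite ?orbT.
Qed.

End Absorption.

(** * Deletions modulo exchanges of letters *)

Section Deletion.
Context {T : eqType} (e : rel T).
Hypothesis e_irr : irreflexive e.
Implicit Types (a b c p q u v w : seq T) (s t x y : T).

Definition conn x y := [|| x == y, e x y | e y x].

(** Equality in the partially commutative monoid where the letters not joined by an
arrow commute, given by projections instead of by sequences of exchanges: it is an
equivalence and a congruence at once, and it locates a given occurrence of a
letter in both words. *)
Definition trace_eq u v := forall x y, conn x y ->
  [seq z <- u | pred2 x y z] = [seq z <- v | pred2 x y z].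

Lemma conn_sym x y : conn x y = conn y x.
Proof. by rewrite /conn eq_sym [e x y || _]orbC. Qed.

Lemma trace_eq_sym u v : trace_eq u v -> trace_eq v u.
Proof. by move=> uv x y xy; rewrite uv. Qed.

Lemma trace_eq_trans v u w : trace_eq u v -> trace_eq v w -> trace_eq u w.
Proof. by move=> uv vw x y xy; rewrite uv ?vw. Qed.

Lemma trace_eq_cat u u' v v' :
  trace_eq u u' -> trace_eq v v' -> trace_eq (u ++ v) (u' ++ v').
Proof. by move=> uu' vv' x y xy; rewrite !filter_cat uu' ?vv'. Qed.

Lemma trace_eq_count t u v : trace_eq u v -> count_mem t u = count_mem t v.
Proof.
move=> /(_ t t); rewrite /conn eqxx => /(_ isT)/(congr1 size); rewrite !size_filter.
by rewrite !(@eq_count _ (pred2 t t) (pred1 t)) // => z /=; rewrite orbb.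
Qed.

Lemma trace_eq_size u v : trace_eq u v -> size u = size v.
Proof.
move=> uv; apply/perm_size/allP => t _; apply/eqP; exact: trace_eq_count.
Qed.

(** The word [c] may contain [t] itself: crossing another [t] changes nothing. *)
Lemma trace_eq_slide t c : all (fun x => ~~ e x t) c -> all (fun x => ~~ e t x) c ->
  trace_eq (t :: c) (rcons c t).
Proof.
move=> nin nout x y xy; rewrite -cats1 filter_cat /=; case: ifP; last by rewrite cats0.
move=> txy; suff /all_pred1P-> : all (pred1 t) [seq z <- c | pred2 x y z].
  by rewrite -[t :: nseq _ _]/(nseq _.+1 t) -addn1 nseqD.
apply/allP=> z; rewrite mem_filter => /andP[/= zxy zc].
have : conn t z.
  case/orP: txy => /eqP->; case/orP: zxy => /eqP->; rewrite // ?(conn_sym y) //.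
    by rewrite /conn eqxx.
  by rewrite /conn eqxx.
rewrite /conn (negbTE (allP nin z zc)) (negbTE (allP nout z zc)) !orbF.
by rewrite /= eq_sym.
Qed.

Definition deletable a t b :=
  absorbs (fun x y => e y x) t (rev a) || absorbs e t b.

Inductive del : seq T -> seq T -> Prop :=
  Del a t b : deletable a t b -> del (a ++ t :: b) (a ++ b).

Lemma del_size u p : del u p -> size u = (size p).+1.
Proof. by case=> a t b _; rewrite !size_cat addnS. Qed.

Lemma del_cat c1 c2 u p : del u p -> del (c1 ++ u ++ c2) (c1 ++ p ++ c2).
Proof.
case=> a t b abt; have := @Del (c1 ++ a) t (b ++ c2); rewrite -!catA cat_cons; apply.
move: abt; rewrite /deletable rev_cat !absorbs_cat.
by case/orP=> ->; rewrite ?orbT.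
Qed.

(** The same occurrence of [t], counted from the left, can be deleted in both words:
on each pair formed by [t] and a joined letter, the projections of the two words
agree before and after this occurrence. *)
Lemma del_trace_eq u v p : trace_eq u v -> del u p ->
  exists q, del v q /\ trace_eq p q.
Proof.
move=> uv dup; case: dup uv => a t b abt uv.
have /count_split[a' [b' [def_v ca']]] : (count_mem t a < count_mem t v)%N.
  by rewrite -(trace_eq_count t uv) count_cat /= eqxx addnCA leq_addr.
have projt x : conn t x ->
    [seq z <- a | pred2 t x z] = [seq z <- a' | pred2 t x z] /\
    [seq z <- b | pred2 t x z] = [seq z <- b' | pred2 t x z].
  move=> /uv; rewrite def_v !filter_cat /= eqxx; apply: eq_cat_count.
  have cE c : count_mem t [seq z <- c | pred2 t x z] = count_mem t c.
    by rewrite count_filter; apply: eq_count => z /=; case: (z == t).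
  by rewrite !cE.
exists (a' ++ b'); split.
  rewrite def_v; apply: Del; move: abt; rewrite /deletable.
  rewrite -(@eq_absorbs _ _ t (rev a) (rev a')) ?e_irr //=; last first.
    move=> x tx; rewrite !filter_rev (projt x _).1 // /conn.
    by case/orP: tx => ->; rewrite ?orbT.
  rewrite -(@eq_absorbs _ _ t b b') ?e_irr // => x tx.
  by rewrite (projt x _).2 // /conn; case/orP: tx => ->; rewrite ?orbT.
move=> x y xy; have [tx|ntx] := eqVneq t x.
  by rewrite -tx in xy *; have [eqa eqb] := projt y xy; rewrite !filter_cat eqa eqb.
have [ty|nty] := eqVneq t y.
  rewrite -ty conn_sym in xy *; have [eqa eqb] := projt x xy.
  have swap c : [seq z <- c | pred2 x t z] = [seq z <- c | pred2 t x z].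
    by apply: eq_filter => z /=; rewrite orbC.
  by rewrite !swap !filter_cat eqa eqb.
by have := uv x y xy; rewrite def_v !filter_cat /= (negbTE ntx) (negbTE nty).
Qed.

(** If deleting [t] becomes impossible once [s] is deleted, then [s = t] and this
occurrence of [s] was the one absorbing [t], so nothing in [c] has an arrow to [t];
in the other order nothing in [c] receives an arrow from [t]. In the first
case, [s] could be deleted on account of [a], which then absorbs [t] too, or
on account of what follows. The latter leaves a [t] in [c], which absorbs
too, or a [c] without any neighbour of [t], which [t] can cross. *)
Lemma del_far_apart a s c t b :
  deletable a s (c ++ t :: b) -> deletable (a ++ s :: c) t b ->
  trace_eq (a ++ c ++ t :: b) (a ++ s :: c ++ b) \/
  deletable (a ++ c) t b /\ deletable a s (c ++ b).
Proof.
set d := fun x y => e y x.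
have [close|far] := boolP
  [&& s == t, all (fun x => ~~ e x t) c & all (fun x => ~~ e t x) c].
  left; case/and3P: close => /eqP-> nin nout.
  apply: trace_eq_cat => //; rewrite -cat_cons -cat_rcons.
  by apply: trace_eq_cat => //; apply/trace_eq_sym/trace_eq_slide.
have {}far : s = t -> all (fun x => ~~ e x t) c -> all (fun x => ~~ e t x) c -> False.
  by move=> st nin nout; rewrite st eqxx nin nout in far.
rewrite /deletable !rev_cat rev_cons -cats1 -catA /= => delS delT; right.
have outS : absorbs e s (c ++ t :: b) ->
    absorbs e s (c ++ b) \/ s = t /\ all (fun x => ~~ e t x) c.
  move=> /absorbs_del/orP[|/andP[/eqP<- nout]]; first by left.
  by right.
have inT : absorbs d t (rev c ++ s :: rev a) ->
    absorbs d t (rev c ++ rev a) \/ s = t /\ all (fun x => ~~ e x t) c.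
  move=> /absorbs_del/orP[|/andP[/eqP<- nin]]; first by left.
  by right; rewrite -(all_rev _ c).
split.
  case/orP: delT => [/inT[->//|[st nin]]|->]; last by rewrite orbT.
  rewrite absorbs_cat all_rev nin /=.
  case/orP: delS => [As|]; first by rewrite -st As orbT.
  rewrite absorbs_cat => /orP[/absorbs_mem sc|/andP[nout _]].
    by rewrite mem_absorbs ?all_rev // mem_rev -st.
  by rewrite st in nout; case: (far st nin nout).
case/orP: delS => [->//|/outS[->|[st nout]]]; first by rewrite orbT.
rewrite [X in _ || X]absorbs_cat st nout /=.
case/orP: delT => [|->]; last by rewrite !orbT.
rewrite absorbs_cat all_rev => /orP[/absorbs_mem|/andP[nin _]].
  by rewrite mem_rev => tc; rewrite (mem_absorbs tc nout) /= orbT.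
by case: (far st nin nout).
Qed.

Lemma del_diamond u p q : del u p -> del u q ->
  trace_eq p q \/ exists r, del p r /\ del q r.
Proof.
have apart a s c t b :
    deletable a s (c ++ t :: b) -> deletable (a ++ s :: c) t b ->
    trace_eq (a ++ c ++ t :: b) (a ++ s :: c ++ b) \/
    exists r, del (a ++ c ++ t :: b) r /\ del (a ++ s :: c ++ b) r.
  move=> ds dt; have [|[dt' ds']] := del_far_apart ds dt; [by left|right].
  by exists (a ++ c ++ b); split; [rewrite !catA|]; apply: Del.
move=> dup; case: dup => {u p} a1 s b1 ds; move def_u: (a1 ++ s :: b1) => u duq.
case: duq def_u => a2 t b2 dt /eq_cat_cons[[-> _ ->]|[c [ea eb]]|[c [ea eb]]].
- by left.
- by rewrite ea eb -catA /= in ds dt *; apply: apart.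
rewrite ea eb -catA /= in ds dt *; have [|[r []]] := apart _ _ _ _ _ dt ds.
  by left; apply: trace_eq_sym.
by right; exists r.
Qed.

(** At most one deletion, then exchanges. Allowing no deletion at all makes this
relation strongly confluent, so that no termination argument is needed. *)
Definition red u v := exists p, (u = p \/ del u p) /\ trace_eq p v.

Lemma red_trace_eq u v : trace_eq u v -> red u v.
Proof. by move=> uv; exists u; split; [left|]. Qed.

Lemma red_refl u : red u u. Proof. exact: red_trace_eq. Qed.

Lemma red_del u v : del u v -> red u v.
Proof. by move=> uv; exists v; split; [right|]. Qed.

Lemma trace_eq_red u v p : trace_eq u v -> red u p -> red v p.
Proof.
move=> uv [q [[<-|/(del_trace_eq uv)[q' [vq' qq']]] qp]].
  by apply: red_trace_eq; apply: trace_eq_trans qp; apply: trace_eq_sym.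
by exists q'; split; [right | apply: trace_eq_trans qp; apply: trace_eq_sym].
Qed.

Lemma red_strongly_confluent : Strongly_confluent (seq T) red.
Proof.
move=> u p q [p' [[<-|up'] p'p]] [q' [[<-|uq'] q'q]].
- exists q; split; last exact: red_refl.
  by apply: red_trace_eq; apply: trace_eq_trans q'q; apply: trace_eq_sym.
- exists q; split; last exact: red_refl.
  by apply: (trace_eq_red p'p); exists q'; split; [right|].
- exists p; split; first exact: red_refl.
  by apply: (trace_eq_red q'q); exists p'; split; [right|].
have [pq'|[r [pr qr]]] := del_diamond up' uq'.
  exists q; split; last exact: red_refl.
  apply: (trace_eq_red p'p); apply: red_trace_eq.
  exact: trace_eq_trans pq' q'q.
exists r; split.
  exact: (trace_eq_red p'p (red_del pr)).
exact: (trace_eq_red q'q (red_del qr)).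
Qed.

Definition joinable := coherent (seq T) red.

Lemma joinable_refl u : joinable u u.
Proof. by exists u; split; apply: Rstar_0. Qed.

Lemma joinable_sym u v : joinable u v -> joinable v u.
Proof. exact: coherent_symmetric. Qed.

Lemma joinable_trans v u w : joinable u v -> joinable v w -> joinable u w.
Proof.
move=> [p [up vp]] [q [vq wq]].
have [r [pr qr]] := Strong_confluence _ _ red_strongly_confluent v p q vp vq.
by exists r; split; [apply: Rstar_transitive up pr | apply: Rstar_transitive wq qr].
Qed.

Lemma joinable_trace_eq u v : trace_eq u v -> joinable u v.
Proof. by move=> uv; apply/Rstar_imp_coherent/Rstar_contains_R/red_trace_eq. Qed.

Lemma joinable_del u v : del u v -> joinable u v.
Proof. by move=> uv; apply/Rstar_imp_coherent/Rstar_contains_R/red_del. Qed.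

Lemma joinable_cat u u' v v' :
  joinable u u' -> joinable v v' -> joinable (u ++ v) (u' ++ v').
Proof.
have ctx c1 c2 w w' : Rstar _ red w w' -> Rstar _ red (c1 ++ w ++ c2) (c1 ++ w' ++ c2).
  elim=> [{}w|{w w'} w1 w2 w3 [p [wp pw]] _ IH]; first exact: Rstar_0.
  apply: Rstar_n IH; exists (c1 ++ p ++ c2).
  split; first by case: wp => [->|/del_cat]; [left|right].
  by apply: trace_eq_cat => //; apply: trace_eq_cat.
move=> [p [up u'p]] [q [vq v'q]].
have joint w w' : Rstar _ red w p -> Rstar _ red w' q -> Rstar _ red (w ++ w') (p ++ q).
  move=> wp w'q; apply: (Rstar_transitive _ _ _ (p ++ w')).
    exact: (ctx [::] w').
  by have := ctx p [::] _ _ w'q; rewrite !cats0.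
by exists (p ++ q); split; apply: joint.
Qed.

(** Every reduction of [v] consists of exchanges only. Those of [u] end in a word
of the length of [v], which leaves no room for a deletion in [u] either. *)
Lemma joinable_shortest u v :
  joinable u v -> (size u <= size v)%N -> (forall p, ~ del v p) -> trace_eq u v.
Proof.
move=> [w [uw vw]] le_uv v_irr.
have {}vw : trace_eq v w.
  elim: vw v_irr {le_uv uw} => // {}v p {}w [q [[<-|vq] qp]] _ IH v_irr.
    apply: (trace_eq_trans qp); apply: IH => r /(del_trace_eq (trace_eq_sym qp)).
    by case=> s [/v_irr].
  by case: (v_irr q).
apply: (trace_eq_trans _ (trace_eq_sym vw)).
have {le_uv v_irr} le_uw : (size u <= size w)%N by rewrite -(trace_eq_size vw).
have red_size p q : red p q -> (size q <= size p)%N.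
  by move=> [r [[->|/del_size->] /trace_eq_size->]].
have rstar_size p q : Rstar _ red p q -> (size q <= size p)%N.
  by elim=> // {}p {}q r /red_size le_qp _ le_rq; apply: leq_trans le_rq le_qp.
elim: uw le_uw {vw} => // {}u p {}w [q [uq qp]] /rstar_size le_wp IH le_uw.
case: uq => [eq_uq|/del_size def_u].
  rewrite eq_uq; apply: (trace_eq_trans qp); apply: IH.
  by rewrite -(trace_eq_size qp) -eq_uq.
by move: le_uw; rewrite def_u (trace_eq_size qp) => /leq_trans/(_ le_wp); rewrite ltnn.
Qed.

End Deletion.

(** * Congruent words and the reductions *)

Local Open Scope ring_scope.
Local Notation "x '*m' y" := (@mmul _ x y) (at level 40, left associativity).

Section Words.
Context {n : nat} (e : rel 'I_n).
Hypothesis He : oriented_graph e.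
Local Notation F := {fmonom 'I_n}.
Implicit Types (u v w l r : F) (t x y : 'I_n).

Let e_irr : irreflexive e := He.1.

Lemma arrow_asym x y : e x y -> ~~ e y x.
Proof. by move=> exy; have := He.2 x y; rewrite exy. Qed.

Lemma fmonom_inj u v : u = v :> seq 'I_n -> u = v.
Proof. exact: val_inj. Qed.

Lemma fmonom_cons t (s : seq 'I_n) : FMonom (t :: s) = fmu t *m FMonom s.
Proof. by apply: fmonom_inj; rewrite fmM fmU. Qed.

Lemma occ_eq0 t w : (occ t w == 0%N) = (t \notin (w : seq 'I_n)).
Proof. by rewrite /occ -has_pred1 has_count -eqn0Ngt. Qed.

Lemma in_word_supp t w : (t \in word_supp w) = (t \in (w : seq 'I_n)).
Proof. by rewrite inE lt0n occ_eq0 negbK. Qed.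

Lemma no_arrow_toE w t :
  no_arrow_to e w t = (t \notin (w : seq 'I_n)) && all (fun x => ~~ e x t) w.
Proof.
rewrite /no_arrow_to occ_eq0 negb_exists_in; congr (_ && _).
by apply/forall_inP/allP => nw x xw; apply: nw; rewrite ?in_word_supp // -in_word_supp.
Qed.

Lemma no_arrow_fromE w t :
  no_arrow_from e t w = (t \notin (w : seq 'I_n)) && all (fun x => ~~ e t x) w.
Proof.
rewrite /no_arrow_from occ_eq0 negb_exists_in; congr (_ && _).
by apply/forall_inP/allP => nw x xw; apply: nw; rewrite ?in_word_supp // -in_word_supp.
Qed.

(** Transitivity is where confluence enters. *)
Lemma hk_cong_joinable u v : hk_cong e u v -> joinable e u v.
Proof.
elim=> {u v} [u v []|u|u v _|u v w _ uv _|u u' v v' _ uu' _ vv'].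
- move=> i; rewrite fmM !fmU; apply: joinable_del.
  by apply: (@Del _ e [::] i [:: i]); rewrite /deletable /= eqxx.
- move=> i j eij eji; rewrite !fmM !fmU; apply: joinable_trace_eq.
  by apply: (@trace_eq_slide _ e i [:: j]); rewrite /= ?eij ?eji.
- move=> i j eij; rewrite !fmM !fmU; apply: joinable_del.
  apply: (@Del _ e [:: i; j] i [::]).
  by rewrite /deletable /= eqxx (arrow_asym eij) orbT.
- move=> i j eij; rewrite !fmM !fmU; apply: joinable_del.
  apply: (@Del _ e [::] j [:: i; j]).
  by rewrite /deletable /= eqxx (arrow_asym eij) orbT.
- exact: joinable_refl.
- exact: joinable_sym.
- exact: joinable_trans.
- by rewrite !fmM; apply: joinable_cat.
Qed.

Definition reducible w := exists l r, hk_reduction e l r /\ word_factor l w.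

Lemma reducible_factor l r (s1 s2 : seq 'I_n) w :
  hk_reduction e l r -> w = s1 ++ l ++ s2 :> seq 'I_n -> reducible w.
Proof.
move=> red_lr def_w; exists l, r; split=> //.
by exists (FMonom s1), (FMonom s2); apply: fmonom_inj; rewrite !fmM -catA.
Qed.

Lemma del_reducible w p : del e w p -> reducible w.
Proof.
move def_w: (fmonom_val w) => s ds; case: ds def_w => a t b.
case/orP=> /absorbs_split[c [d [def tc nc]]] def_w.
  have red_c : hk_reduction e
      (fmu t *m FMonom (rev c) *m fmu t) (fmu t *m FMonom (rev c)).
    by apply: red_i; rewrite no_arrow_toE /= mem_rev tc all_rev.
  apply: (reducible_factor (s1 := rev d) (s2 := b) red_c).
  by rewrite def_w !fmM !fmU -[a]revK def rev_cat rev_cons -!cats1 /= -!catA.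
have red_c : hk_reduction e (fmu t *m FMonom c *m fmu t) (FMonom c *m fmu t).
  by apply: red_ii; rewrite no_arrow_fromE /= tc.
apply: (reducible_factor (s1 := a) (s2 := d) red_c).
by rewrite def_w !fmM !fmU def /= -!catA.
Qed.

Lemma trace_eq_consK t (s s' : seq 'I_n) :
  trace_eq e (t :: s) (t :: s') -> trace_eq e s s'.
Proof. by move=> ss' x y xy; have := ss' x y xy => /=; case: ifP => // _ []. Qed.

(** A letter of [b] joined to [t] would precede [t] in one projection and follow
it in the other. *)
Lemma trace_eq_head t (s b c : seq 'I_n) : trace_eq e (t :: s) (b ++ t :: c) ->
  t \notin b -> all (fun x => ~~ conn e t x) b.
Proof.
move=> tsb tb; apply/allP=> x xb; apply/negP=> tx.
have := tsb t x tx; rewrite filter_cat /= eqxx /=.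
have : x \in [seq z <- b | pred2 t x z] by rewrite mem_filter /= eqxx orbT.
case def_b: [seq z <- b | pred2 t x z] => [|y b'] //= _ [ty _].
have : y \in b by have := mem_head y b'; rewrite -def_b mem_filter => /andP[].
by rewrite -ty (negbTE tb).
Qed.

(** At the first difference [s] has a letter [t2] and [s'] a letter [t1 > t2]; the
first [t2] of [s'] after this place is preceded only by letters not joined to it. *)
Lemma lexi_trace_eq (s s' : seq 'I_n) : trace_eq e s s' ->
  ((s : seqlexi 'I_n) <= (s' : seqlexi 'I_n))%O -> s != s' ->
  exists (a : seq 'I_n) t1 (c : seq 'I_n) t2 (b : seq 'I_n),
    [/\ s' = a ++ (t1 :: c ++ [:: t2]) ++ b, (t2 < t1)%O, t2 \notin t1 :: c
      & all (fun x => ~~ conn e t2 x) (t1 :: c)].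
Proof.
elim: s s' => [|y s IH] [|x s'] // ss'.
  by have /trace_eq_size := ss'.
rewrite lexi_cons; have [eq_yx|neq] := eqVneq y x.
  rewrite eq_yx lexx /= eqseq_cons eqxx /= in ss' *.
  move=> le_ss' neq_ss'.
  have [a [t1 [w [t2 [b [-> lt12 tw nw]]]]]] :=
    IH _ (trace_eq_consK ss') le_ss' neq_ss'.
  by exists (x :: a), t1, w, t2, b.
rewrite le_eqVlt (negbTE neq) /= => /andP[lt_yx _] _.
have [|b1 [b2 [def_s' cb1]]] := @count_split _ y 0 (x :: s').
  by rewrite -(trace_eq_count y ss') /= eqxx.
have yb1 : y \notin b1 by rewrite -has_pred1 has_count cb1.
rewrite def_s' in ss'; have nb1 := trace_eq_head ss' yb1.
case: b1 def_s' yb1 nb1 {cb1 ss'} => [[eq_xy]|_ b1 [<- def_s']] yb1 nb1.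
  by rewrite eq_xy eqxx in neq.
by exists [::], x, b1, y, b2; rewrite /= def_s' -catA.
Qed.

(** A word that is not minimal in its class admits a deletion, hence a factor of
type (i) or (ii), or else differs from the smaller word by exchanges, hence
has a factor of type (iii). *)
Lemma smaller_cong_reducible u v :
  hk_cong e u v -> deglex_le u v -> u != v -> reducible v.
Proof.
move=> /hk_cong_joinable uv le_uv neq_uv.
have [[p vp]|v_irr] := pselect (exists p, del e v p); first exact: del_reducible vp.
have le_size : (size u <= size v)%N.
  by case/orP: le_uv => [/ltnW//|/andP[/eqP->]].
have eq_uv : trace_eq e u v.
  by apply: (joinable_shortest e_irr uv le_size) => p vp; apply: v_irr; exists p.
case/orP: le_uv; first by rewrite (trace_eq_size eq_uv) ltnn.
rewrite (trace_eq_size eq_uv) eqxx /= => le_uv.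
have [//|a [t1 [w [t2 [b [def_v lt21 t2w nw]]]]]] := lexi_trace_eq eq_uv le_uv.
have red_w : hk_reduction e
    (fmu t1 *m FMonom w *m fmu t2) (fmu t2 *m fmu t1 *m FMonom w).
  apply: red_iii => //; rewrite /no_arrow no_arrow_toE no_arrow_fromE fmM fmU /= t2w /=.
  have nto : all (fun x => ~~ e x t2) (t1 :: w).
    by apply: sub_all nw => x; rewrite !negb_or => /and3P[].
  have nfrom : all (fun x => ~~ e t2 x) (t1 :: w).
    by apply: sub_all nw => x; rewrite !negb_or => /and3P[].
  by move: nto nfrom => /= -> ->.
apply: (reducible_factor red_w (s1 := a) (s2 := b)).
by rewrite def_v !fmM !fmU /= -catA.
Qed.

Lemma hk_reduction_deglex l r : hk_reduction e l r -> deglex_le r l /\ r != l.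
Proof.
have shorter w w' : (size w < size w')%N -> deglex_le w w' /\ w != w'.
  rewrite /deglex_le => lt_ww'; rewrite lt_ww'; split=> //.
  by apply: contraTneq lt_ww' => ->; rewrite ltnn.
case=> [t w _|t w _|t1 t2 w lt21 _].
- by apply: shorter; rewrite !fmM !fmU !size_cat /= addn1.
- by apply: shorter; rewrite !fmM !fmU !size_cat /= add1n addSn.
split; last first.
  rewrite fmP !fmM !fmU /= eqseq_cons.
  by apply: contraTN lt21 => /andP[/eqP-> _]; rewrite ltxx.
rewrite /deglex_le !fmM !fmU /= !size_cat /= addn1 eqxx /=.
by rewrite lexi_cons (ltW lt21) leNgt lt21 orbT.
Qed.

Local Notation "x '*h' y" := (hk_mul x y) (at level 40, left associativity).
Local Notation gen t := (hk_pi e (fmu t)).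

Lemma hk_gen_absorb_right t x : ~~ e x t -> gen t *h gen x *h gen t = gen t *h gen x.
Proof.
move=> nxt; rewrite -!hk_pi_mul; have [etx|ntx] := boolP (e t x).
  by apply/hk_piP/hk_cong_rel/hk_arrow_l.
rewrite -mulmA !hk_pi_mul -(hk_pi_mul e (fmu x)).
rewrite (iffRL (hk_piP e _ _) (hk_cong_rel (hk_comm nxt ntx))).
rewrite hk_pi_mul hk_mulA -hk_pi_mul.
by rewrite (iffRL (hk_piP e _ _) (hk_cong_rel (hk_idem e t))).
Qed.

Lemma hk_gen_absorb_left t x : ~~ e t x -> gen t *h gen x *h gen t = gen x *h gen t.
Proof.
move=> ntx; rewrite -!hk_pi_mul; have [ext|nxt] := boolP (e x t).
  by apply/hk_piP/hk_cong_rel/hk_arrow_r.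
rewrite !hk_pi_mul -(hk_pi_mul e (fmu t)).
rewrite (iffRL (hk_piP e _ _) (hk_cong_rel (hk_comm ntx nxt))).
rewrite hk_pi_mul -hk_mulA -hk_pi_mul.
by rewrite (iffRL (hk_piP e _ _) (hk_cong_rel (hk_idem e t))).
Qed.

(** Each letter [x] of [w] satisfies [t x = t x t]: so [t] can be
carried along through [w] and is absorbed by the last [t]. *)
Lemma hk_word_absorb_right t w : all (fun x => ~~ e x t) w ->
  gen t *h hk_pi e w *h gen t = gen t *h hk_pi e w.
Proof.
case: w; elim=> [|x s IH] /=.
  have -> : FMonom [::] = mone :> F by apply: fmonom_inj; rewrite fm1.
  rewrite -/(hk_one e) hk_mulr1 -hk_pi_mul => _.
  by apply/hk_piP/hk_cong_rel/hk_idem.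
case/andP=> nxt /IH {}IH; rewrite fmonom_cons hk_pi_mul hk_mulA.
rewrite -{1}hk_gen_absorb_right //; move: IH; rewrite -!hk_mulA => ->.
by rewrite !hk_mulA hk_gen_absorb_right.
Qed.

Lemma hk_word_absorb_left t w : all (fun x => ~~ e t x) w ->
  gen t *h hk_pi e w *h gen t = hk_pi e w *h gen t.
Proof.
case: w; elim=> [|x s IH] /=.
  have -> : FMonom [::] = mone :> F by apply: fmonom_inj; rewrite fm1.
  rewrite -/(hk_one e) hk_mulr1 hk_mul1 -hk_pi_mul => _.
  by apply/hk_piP/hk_cong_rel/hk_idem.
case/andP=> ntx /IH {}IH; rewrite fmonom_cons hk_pi_mul -!hk_mulA -IH.
by rewrite !hk_mulA hk_gen_absorb_left.
Qed.

Lemma hk_word_comm t w : all (fun x => ~~ conn e t x) w ->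
  hk_pi e w *h gen t = gen t *h hk_pi e w.
Proof.
case: w; elim=> [|x s IH] /=.
  have -> : FMonom [::] = mone :> F by apply: fmonom_inj; rewrite fm1.
  by rewrite -/(hk_one e) hk_mulr1 hk_mul1.
rewrite {1}/conn !negb_or -!andbA => /and4P[_ ntx nxt /IH {}IH].
rewrite fmonom_cons hk_pi_mul -hk_mulA IH !hk_mulA -2!(hk_pi_mul e (fmu _)).
by congr (_ *h _); apply/hk_piP/hk_cong_rel/hk_comm.
Qed.

Lemma hk_reduction_cong l r : hk_reduction e l r -> hk_cong e l r.
Proof.
case=> [t w|t w|t1 t2 w lt21]; rewrite ?no_arrow_toE ?no_arrow_fromE.
- by case/andP=> _ nw; apply/hk_piP; rewrite !hk_pi_mul hk_word_absorb_right.
- by case/andP=> _ nw; apply/hk_piP; rewrite !hk_pi_mul hk_word_absorb_left.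
rewrite /no_arrow no_arrow_toE no_arrow_fromE => /andP[/andP[t2w nto] /andP[_ nfrom]].
apply/hk_piP; rewrite -(mulmA (fmu t2)) (hk_pi_mul _ (_ *m w)) (hk_pi_mul _ _ (_ *m w)).
rewrite hk_word_comm //.
apply/allP=> x xw; rewrite /conn !negb_or (allP nto _ xw) (allP nfrom _ xw) !andbT.
by apply: contraNneq t2w => ->.
Qed.

End Words.

(** * The ideal of the reductions and leading monomials *)

Section Ideals.
Context {n : nat} {k : fieldType}.
Local Notation F := {fmonom 'I_n}.
Implicit Types (f g h : {malg k[F]}) (G : {malg k[F]} -> Prop).

Lemma ideal_genG G g : G g -> two_sided_ideal_gen G g.
Proof.
move=> Gg; exists [:: (1, g, 1)]; rewrite big_seq1 /= mul1r mulr1.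
by split=> // p; rewrite inE => /eqP->.
Qed.

Lemma ideal_gen0 G : two_sided_ideal_gen G 0.
Proof. by exists [::]; rewrite big_nil. Qed.

Lemma ideal_genD G f g :
  two_sided_ideal_gen G f -> two_sided_ideal_gen G g -> two_sided_ideal_gen G (f + g).
Proof.
move=> [s [sG ->]] [s' [s'G ->]]; exists (s ++ s'); rewrite big_cat; split=> // p.
by rewrite mem_cat => /orP[/sG|/s'G].
Qed.

Lemma ideal_genM G a b f :
  two_sided_ideal_gen G f -> two_sided_ideal_gen G (a * f * b).
Proof.
move=> [s [sG ->]]; exists [seq (a * p.1.1, p.1.2, p.2 * b) | p <- s]; split.
  by move=> p /mapP[q /sG Gq ->].
rewrite big_map mulr_sumr mulr_suml; apply: eq_bigr => p _.
have assoc (R : pzRingType) (x y z c d : R) : x * (y * z * c) * d = x * y * z * (c * d).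
  by rewrite !mulrA.
exact: assoc.
Qed.

Lemma ideal_genMl G a f : two_sided_ideal_gen G f -> two_sided_ideal_gen G (a * f).
Proof. by move=> /(ideal_genM a 1); rewrite mulr1. Qed.

Lemma ideal_genMr G b f : two_sided_ideal_gen G f -> two_sided_ideal_gen G (f * b).
Proof. by move=> /(ideal_genM 1 b); rewrite mul1r. Qed.

Lemma ideal_genN G f : two_sided_ideal_gen G f -> two_sided_ideal_gen G (- f).
Proof. by move=> /(ideal_genMl (-1)); rewrite mulN1r. Qed.

Lemma ideal_genB_trans G f g h : two_sided_ideal_gen G (f - g) ->
  two_sided_ideal_gen G (g - h) -> two_sided_ideal_gen G (f - h).
Proof. by move=> /ideal_genD H /H; rewrite addrA subrK. Qed.

Lemma ideal_genB_mul G f f' g g' : two_sided_ideal_gen G (f - f') ->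
  two_sided_ideal_gen G (g - g') -> two_sided_ideal_gen G (f * g - f' * g').
Proof.
move=> ff' gg'; apply: (@ideal_genB_trans _ _ (f' * g)).
  by rewrite -mulrBl; apply: ideal_genMr.
by rewrite -mulrBr; apply: ideal_genMl.
Qed.

Lemma ideal_gen_sum G (I : Type) (s : seq I) (E : I -> {malg k[F]}) :
  (forall i, two_sided_ideal_gen G (E i)) -> two_sided_ideal_gen G (\sum_(i <- s) E i).
Proof.
move=> GE; elim/big_ind: _ => //; [exact: ideal_gen0 | exact: ideal_genD].
Qed.

Lemma malg_wordM (u v : F) : << u *m v >> = << u >> * << v >> :> {malg k[F]}.
Proof. by rewrite malgM_def fgmulUU mulr1. Qed.

Context (e : rel 'I_n).
Hypothesis He : oriented_graph e.
Local Notation ideal := (two_sided_ideal_gen (hk_reduction_set e k)).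

Lemma hk_rel_ideal u v : hk_rel e u v -> ideal (<< u >> - << v >>).
Proof.
have red l r : hk_reduction e l r -> ideal (<< l >> - << r >>).
  by move=> lr; apply: ideal_genG; exists l, r.
case=> [i|i j nij nji|i j eij|i j eij].
- have := red_i (t := i) (w := mone) (e := e); rewrite !mulm1; move=> H; apply/red/H.
  by rewrite no_arrow_toE fm1.
- have comm x y : ~~ e x y -> ~~ e y x -> (y < x)%O ->
      ideal (<< fmu x *m fmu y >> - << fmu y *m fmu x >>).
    move=> nxy nyx lt_yx; have := @red_iii _ e x y mone lt_yx; rewrite !mulm1.
    move=> H; apply/red/H; rewrite /no_arrow no_arrow_toE no_arrow_fromE fmU /=.
    by rewrite inE nxy nyx (lt_eqF lt_yx).
  case: (ltgtP i j) => [lt_ij|lt_ji|->]; last by rewrite subrr; apply: ideal_gen0.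
    by rewrite -opprB; apply/ideal_genN/comm.
  exact: comm.
- apply/red/red_i; rewrite no_arrow_toE fmU /= inE (arrow_asym He eij) !andbT.
  by apply: contraTneq eij => ->; rewrite He.1.
- apply/red/red_ii; rewrite no_arrow_fromE fmU /= inE (arrow_asym He eij) !andbT.
  by apply: contraTneq eij => ->; rewrite He.1.
Qed.

(** The defining relations are instances of the reductions with [w] empty or a
single letter, and the ideal is closed under what generates a congruence. *)
Lemma hk_cong_ideal u v : hk_cong e u v -> ideal (<< u >> - << v >>).
Proof.
elim=> {u v} [u v|u|u v _|v u w _ uv _ vw|u u' v v' _ uu' _ vv'].
- exact: hk_rel_ideal.
- by rewrite subrr; apply: ideal_gen0.
- by move=> uv; rewrite -opprB; apply: ideal_genN.
- exact: ideal_genB_trans uv vw.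
have := ideal_genB_mul uu' vv'; rewrite -(malg_wordM u v) -(malg_wordM u' v'); exact.
Qed.

Lemma hk_natE f : hk_nat e f = \sum_(u <- msupp f) << f@_u *g hk_pi e u >>.
Proof.
rewrite /hk_nat mmapE; apply: eq_bigr => u _.
by rewrite /hk_word malgM_def fgmulUU mulr1 mul1m.
Qed.

(** The map [sigma] sends a class to a chosen representative, so
[f = f - sigma (hk_nat e f)] is a combination of differences of congruent words. *)
Lemma hk_ideal_gen f : hk_ideal k e f -> ideal f.
Proof.
rewrite /hk_ideal => f0.
pose sigma := mmap (@malgC F k) (fun q : HK e => << repr q >> : {malg k[F]}).
have sigma_f :
    \sum_(u <- msupp f) (f@_u)%:MP * << repr (hk_pi e u) >> = 0 :> {malg k[F]}.
  transitivity (sigma (hk_nat e f)); last by rewrite f0 /sigma raddf0.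
  rewrite hk_natE /sigma raddf_sum; apply: eq_bigr => u _.
  by rewrite /= mmapU.
have f_sum : f = \sum_(u <- msupp f) (f@_u)%:MP * << u >>.
  rewrite {1}[f]monalgE; apply: eq_bigr => u _.
  by rewrite malgM_def fgmulUU mulr1 mul1m.
rewrite -[f]subr0 -[X in _ - X]sigma_f [X in X - _]f_sum -sumrB.
apply: ideal_gen_sum => u; rewrite -mulrBr.
apply/ideal_genMl/hk_cong_ideal/hk_piP.
by rewrite /hk_pi reprK.
Qed.

Lemma hk_reduction_set_ideal f : hk_reduction_set e k f -> hk_ideal k e f.
Proof.
move=> [l [r [/(hk_reduction_cong)/hk_piP eq_lr ->]]].
by rewrite /hk_ideal raddfB /= !hk_natU eq_lr subrr.
Qed.

Lemma ideal_gen_hk f : ideal f -> hk_ideal k e f.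
Proof.
move=> [s [sG ->]]; rewrite big_seq /hk_ideal; elim/big_ind: _ => [|g h|p /sG].
- exact: raddf0.
- by rewrite raddfD /= => -> ->; rewrite addr0.
move=> /hk_reduction_set_ideal gp0.
by rewrite 2!(rmorphM (hk_nat e)) /= gp0 mulr0 mul0r.
Qed.

Lemma hk_reduction_lead l r : hk_reduction e l r ->
  lead_monomial (<< l >> - << r >> : {malg k[F]}) l.
Proof.
move=> /hk_reduction_deglex[le_rl neq_rl].
have deglex_refl (w : F) : deglex_le w w by rewrite /deglex_le eqxx lexx orbT.
split=> [|u]; rewrite -mcoeff_neq0 mcoeffB !mcoeffU1.
  by rewrite eqxx (negbTE neq_rl) subr0 oner_neq0.
have [->//|_] := eqVneq l u; have [<-//|_] := eqVneq r u.
by rewrite subrr eqxx.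
Qed.

Lemma deglex_le_total : total (@deglex_le n).
Proof.
move=> u v; rewrite /deglex_le; case: ltngtP => //= _; exact: le_total.
Qed.

Lemma deglex_le_trans : transitive (@deglex_le n).
Proof.
move=> v u w; rewrite /deglex_le.
case: (ltngtP (size u) (size v)) => //= [lt_uv _|->].
  by case/orP=> [/(ltn_trans lt_uv)->//|/andP[/eqP<-]]; rewrite lt_uv.
by move=> le_uv; case: ltngtP => //= _; apply: le_trans.
Qed.

Lemma exists_max (T : eqType) (le : rel T) (s : seq T) :
  total le -> transitive le -> s != [::] ->
  exists u, u \in s /\ forall v, v \in s -> le v u.
Proof.
move=> le_total le_trans; elim: s => [|x [|y s] IH] // _.
  exists x; split=> [|v]; rewrite inE // => /eqP->.
  by have := le_total x x; rewrite orbb.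
have [//|u [us u_max]] := IH; have /orP[le_xu|le_ux] := le_total x u.
  exists u; split=> [|v]; rewrite inE ?us ?orbT // => /orP[/eqP->//|].
  exact: u_max.
exists x; split=> [|v]; rewrite inE ?eqxx // => /orP[/eqP->|/u_max le_vu].
  by have := le_total x x; rewrite orbb.
exact: le_trans le_ux.
Qed.

Lemma exists_lead_monomial f : f != 0 -> exists u, lead_monomial f u.
Proof.
move=> f_neq0; apply: (exists_max deglex_le_total deglex_le_trans).
by apply: contraNneq f_neq0 => msf; rewrite [f]monalgE msf big_nil.
Qed.

Lemma mcoeff_sumU (K : monomType) (G : zmodType) (I : choiceType)
    (s : seq I) (c : I -> G) (p : I -> K) q :
  (\sum_(u <- s) << c u *g p u >>)@_q = \sum_(u <- s | p u == q) c u.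
Proof.
rewrite raddf_sum /= [RHS]big_mkcond; apply: eq_bigr => u _.
by rewrite mcoeffU; case: eqP.
Qed.

Lemma hk_nat_coeff f q :
  (hk_nat e f)@_q = \sum_(u <- msupp f | hk_pi e u == q) f@_u.
Proof. by rewrite hk_natE; apply: mcoeff_sumU. Qed.

(** Otherwise the leading monomial would be alone in its class and its coefficient
would survive in the quotient. *)
Lemma hk_ideal_lead f v : hk_ideal k e f -> lead_monomial f v -> reducible e v.
Proof.
move=> f0 [vf v_max].
suff [u [uf neq_uv uv]] :
    exists u, [/\ u \in msupp f, u != v & hk_cong e u v].
  exact: smaller_cong_reducible (v_max u uf) neq_uv.
apply: contrapT => no_u; move: vf; rewrite -mcoeff_neq0 => /negP; apply.
have := hk_nat_coeff f (hk_pi e v); rewrite f0 mcoeff0 => eq0.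
have [vf|/mcoeff_outdom->//] := boolP (v \in msupp f); rewrite eq0 eq_sym; apply/eqP.
rewrite big_mkcond (bigD1_seq v) ?fset_uniq //=; case: eqP => [_|[]//].
rewrite big_seq_cond big1 ?addr0 // => u /andP[uf neq_uv].
by case: eqP => // /hk_piP uv; case: no_u; exists u.
Qed.

End Ideals.

Theorem theorem3p1 (k : fieldType) (n : nat) (e : rel 'I_n)
    (He : oriented_graph e) :
  groebner_basis (hk_ideal k e) (hk_reduction_set e k).
Proof.
split=> [f|[l [r [red_lr]]]|f|f f_in f_neq0].
- exact: hk_reduction_set_ideal.
- move=> eq_lr; have := @hk_reduction_lead _ k _ _ _ red_lr; rewrite -eq_lr => -[].
  by rewrite msupp0.
- by split; [apply: hk_ideal_gen | apply: ideal_gen_hk].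
have [v lead_v] := exists_lead_monomial f_neq0.
have [l [r [red_lr lv]]] := hk_ideal_lead He f_in lead_v.
exists (<< l >> - << r >>), l, v; split=> //; last exact: hk_reduction_lead red_lr.
by exists l, r.
Qed.
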